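(* Let $n\ge 1$ be an integer, let $p\ge 2$, $q\ge 1$, $\sigma>0$, $\nu\in[0,1]$ with $\nu<p-1$, and $H_\nu>0$ be real numbers, and let $T$ be an integer with $1\le T\le n$. For every $T$-step first-order algorithm on $\mathbb{R}^n$ there exists a convex differentiable function $f:\mathbb{R}^n\to\mathbb{R}$ whose gradient is Hölder continuous of degree $\nu$ with constant $H_\nu$ with respect to the Euclidean norm, i.e. $$\|\nabla f(x)-\nabla f(y)\|\le H_\nu\|x-y\|^\nu\qquad\text{for all }x,y\in\mathbb{R}^n,$$ such that, for the problem $$\min_{x\in\mathbb{R}^n}\Bigl\{F(x):=f(x)+\frac{\sigma}{p}\|x\|_q^p\Bigr\}$$ with optimal value $F^*$, the $T$-th point $x_T$ generated by the algorithm using the first-order oracle of $f$ satisfies $$F(x_T)-F^*\;\ge\;\Bigl(\frac{p-1}{p}\Bigr)^{\frac{(p-1)(1+\nu)}{p-1-\nu}}\Bigl(\frac12\Bigr)^{\frac{(2p-1)(1+\nu)}{p-1-\nu}}\cdot\left(\frac{H_\nu}{\sigma^{\frac{1+\nu}{p}}\,T^{\frac{1+\nu+\nu q}{q}}}\right)^{\frac{p}{p-1-\nu}}.$$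
   Context: Here $\|x\| = \bigl(\sum_{i=1}^n (x^{(i)})^2\bigr)^{1/2}$ is the standard Euclidean norm on $\mathbb{R}^n$, and $\|x\|_q=\bigl(\sum_{i=1}^n|x^{(i)}|^q\bigr)^{1/q}$ is the standard $\ell_q$-norm. The Euclidean norm is used for the smoothness of $f$, and the $\ell_q$-norm for the regularizer. First-order local oracle: for a differentiable $f:\mathbb{R}^n\to\mathbb{R}$ and $x\in\mathbb{R}^n$, the oracle returns $\mathcal{I}(x)=\{f(x),\nabla f(x)\}$. Algorithm: a (deterministic) first-order algorithm is a sequence of mappings $\mathcal{A}=(A_0,A_1,A_2,\dots)$. It generates points in $\mathbb{R}^n$ by $x_1 := A_0(\varnothing)$ (a fixed point not depending on $f$) and $x_{k+1} := A_k(\mathcal{I}(x_1),\dots,\mathcal{I}(x_k))$ for $k\ge 1$. The mappings are arbitrary; the parameters of the regularizer ($\sigma$, $p$ and the norm, i.e. $q$) are directly available to the method, i.e. the mappings may depend on them. A $T$-step algorithm is one that generates the points $x_1,\dots,x_T$, i.e. it is given by the mappings $A_0,\dots,A_{T-1}$. The function $f$ may depend on the algorithm and on all the parameters. $F^* = \min_{x\in\mathbb{R}^n} F(x)$. *)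

(* Defs.v *)
From HB Require Import structures.
From mathcomp Require Import all_boot all_order all_algebra.
From mathcomp Require Import all_classical all_reals all_analysis.

Set Implicit Arguments.
Unset Strict Implicit.
Unset Printing Implicit Defensive.

Import Order.TTheory GRing.Theory Num.Theory.
Import numFieldNormedType.Exports.

Local Open Scope ring_scope.

(* The library norm `|x| on 'rV[R]_n is the sup norm; it only provides the
   (norm-independent) topology used by differentiability. *)
Definition enorm (R : realType) (n : nat) (x : 'rV[R]_n) : R :=
  Num.sqrt (\sum_(i < n) x 0 i ^+ 2).

Definition lqnorm (R : realType) (n : nat) (q : R) (x : 'rV[R]_n) : R :=
  (\sum_(i < n) `|x 0 i| `^ q) `^ q^-1.

Definition gradient (R : realType) (n : nat) (f : 'rV[R]_n -> R)
    (x : 'rV[R]_n) : 'rV[R]_n :=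
  \row_(i < n) 'D_(delta_mx 0 i) f x.

(* At equal points with nu = 0 the right-hand side is H * 0 `^ 0 = H and the
   left-hand side is 0, so the convention for 0 `^ 0 is immaterial. *)
Definition holder_gradient (R : realType) (n : nat) (nu H : R)
    (f : 'rV[R]_n -> R) : Prop :=
  forall x y : 'rV[R]_n,
    enorm (gradient f x - gradient f y) <= H * enorm (x - y) `^ nu.

Definition oracle_answer (R : realType) (n : nat) : Type :=
  (R * 'rV[R]_n)%type.

Definition oracle (R : realType) (n : nat) (f : 'rV[R]_n -> R)
    (x : 'rV[R]_n) : oracle_answer R n :=
  (f x, gradient f x).

(* The mapping A k receives the k answers obtained so far, oldest first; the
   only argument of A 0 is the empty tuple, so the first point does not depend
   on f. A T-step method is determined by A 0, ..., A T.-1, and the later mappings do not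
   affect its first T points. *)
Definition algorithm (R : realType) (n : nat) : Type :=
  forall k : nat, k.-tuple (oracle_answer R n) -> 'rV[R]_n.

Fixpoint answers (R : realType) (n : nat) (A : algorithm R n)
    (f : 'rV[R]_n -> R) (k : nat) : k.-tuple (oracle_answer R n) :=
  match k with
  | 0 => [tuple]
  | j.+1 => [tuple of rcons (answers A f j) (oracle f (A j (answers A f j)))]
  end.

(* Points are numbered from 0 here: query A f k is the (k+1)-st point. *)
Definition query (R : realType) (n : nat) (A : algorithm R n)
    (f : 'rV[R]_n -> R) (k : nat) : 'rV[R]_n :=
  A k (answers A f k).

Definition regularized (R : realType) (n : nat) (sigma p q : R)
    (f : 'rV[R]_n -> R) (x : 'rV[R]_n) : R :=
  f x + sigma / p * lqnorm q x `^ p.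

Definition is_min_value (T : Type) (R : realType) (F : T -> R) (m : R) : Prop :=
  (exists x : T, F x = m) /\ (forall x : T, m <= F x).

(* Main.v *)
Require Import Defs.
From HB Require Import structures.
From mathcomp Require Import all_boot all_order all_algebra.
From mathcomp Require Import all_classical all_reals all_analysis.
From mathcomp Require Import ring lra.

Import Order.TTheory GRing.Theory Num.Theory.
Import numFieldNormedType.Exports.

Local Open Scope ring_scope.

(** The worst-case function is a smoothed maximum of signed coordinates,
    f x = L * smax chi (xi_i x_i - c_i)_i, where smax chi a is the maximum over
    the probability simplex of  <w, a> - (chi / 2) |w|^2  and w = weight chi a
    is its maximizer.

    Regularity of f. The optimality condition on w gives one inequality
    (smax_tangent): smax lies above its tangent at a by at least
    (chi / 2) |w_b - w_a|^2. It yields at once that smax is convex,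
    differentiable with gradient w, and that w is (1/chi)-Lipschitz. Since two
    points of the simplex are also at distance at most 2, interpolating between
    the two bounds shows that the gradient of f is Hoelder of degree nu with
    constant L 2^(1-nu) chi^(-nu).

    Resistance. A coordinate of a lying chi or more below the largest one has
    weight 0, so it influences neither the value nor the gradient (smax_local).
    The adversary therefore fixes the affine pieces one at a time: at the k-th
    query point (k = 0, 1, ...) it takes, among the coordinates not used so
    far, the one where the point is largest in absolute value, chooses the sign
    that makes xi_i x_i nonnegative, and gives it the offset k chi. All pieces
    fixed later have offsets at least (k + 1) chi, so they are inert at this
    point and the answer is already determined (resisting_oracle). At the
    T-th point x_T some signed coordinate xi_i x_i is nonnegative, its offset is
    at most (T - 1) chi, and the smoothing costs at most chi / 2; hence
    F x_T >= f x_T >= - L T chi.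

    Optimal value. At the point with entries - r xi_i on the T coordinates used
    and 0 elsewhere, f is at most - L r and the regularizer equals
    (sigma / p) T^(p/q) r^p. The minimizing r satisfies
    sigma T^(p/q) r^p = L r, which gives F^* <= - ((p - 1) / p) L r. When
    T chi <= ((p - 1) / p) r / 2, at least half of this gap survives, and
    scaling_parameters shows that r, L and chi can be chosen so that the Hoelder
    constant is exactly H and half the gap is exactly the claimed bound. *)

(** * The smoothed maximum of finitely many numbers *)

Lemma continuous_finsum {R : realType} {T : topologicalType} {I : finType} (F : I -> T -> R) :
  (forall i, continuous (F i)) -> continuous (fun x => \sum_i F i x).
Proof.
move=> F_cont; apply: (@continuous_big R I +%R 0 xpredT) => // x.
exact: (@add_continuous R).
Qed.

Section SmoothedMaximum.
Context {R : realType} {I : finType}.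
Implicit Types (chi : R) (a b w mu : I -> R).

(** The third clause is the variational inequality that characterizes w as the
    maximizer of  <w, a> - (chi / 2) |w|^2  on the simplex, equivalently as the
    projection of a / chi onto it. The last clause is what makes entries far
    below the largest one invisible. *)
Definition is_weight chi a w :=
  [/\ forall i, 0 <= w i,
      \sum_i w i = 1,
      forall mu, (forall i, 0 <= mu i) -> \sum_i mu i = 1 ->
        \sum_i (mu i - w i) * (a i - chi * w i) <= 0 &
      forall i j, a j <= a i - chi -> w j = 0].

(** The water level t at which the parts of a above t have total size chi; it
    exists by the intermediate value theorem between max a - chi and max a. *)
Lemma water_level chi a (i0 : I) : 0 < chi ->
  exists t, \sum_i Num.max 0 (a i - t) = chi /\ forall i, a i - chi <= t.
Proof.
move=> chi0.
have [m mP] : exists m, forall i, a i <= a m.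
  by case: (@arg_maxP _ _ _ i0 xpredT a isT) => m _ mP; exists m => i; exact: mP.
pose phi t := \sum_i Num.max 0 (a i - t).
have phi_cont : continuous phi.
  apply: continuous_finsum => i t.
  apply: (@continuous_max _ _ (fun=> 0) (fun t => a i - t)); first exact: cst_continuous.
  by apply: continuousB => //; exact: cst_continuous.
have phi_hi : phi (a m) = 0.
  by apply: big1 => i _; apply/max_idPl; rewrite subr_le0 mP.
have phi_lo : chi <= phi (a m - chi).
  rewrite /phi (bigD1 m) //= subKr (max_idPr (ltW chi0)) lerDl.
  by apply: sumr_ge0 => i _; rewrite le_max lexx.
have [|||t] := @IVT R phi (a m - chi) (a m) chi.
- by rewrite lerBlDr lerDl ltW.
- exact: continuous_subspaceT.
- by rewrite phi_hi ge_min le_max phi_lo (ltW chi0) !orbT.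
rewrite in_itv /= => /andP[t_lo _] phit; exists t; split=> // i.
by apply: le_trans t_lo; rewrite lerD2r mP.
Qed.

(** The excesses over the water level t, divided by chi, are the weights: then
    a i - chi * w i = min (a i) t, which equals t wherever w i > 0, so that no
    other distribution mu gets a larger average than t. *)
Lemma exists_weight chi a (i0 : I) : 0 < chi -> exists w, is_weight chi a w.
Proof.
move=> chi0; have [t [sum_t t_ge]] := water_level chi a i0 chi0.
pose w i := Num.max 0 (a i - t) / chi.
have w0 i : 0 <= w i by rewrite divr_ge0 ?(ltW chi0) // le_max lexx.
have sw : \sum_i w i = 1 by rewrite -mulr_suml sum_t divff ?gt_eqF.
have chiw i : chi * w i = Num.max 0 (a i - t) by rewrite mulrC divfK ?gt_eqF.
exists w; split => // [mu mu0 smu|i j aj]; last first.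
  rewrite /w (_ : Num.max _ _ = 0) ?mul0r //; apply/max_idPl.
  by rewrite subr_le0 (le_trans aj) // t_ge.
have step i : (mu i - w i) * (a i - chi * w i) <= (mu i - w i) * t.
  rewrite chiw; case: (leP (a i - t) 0) => [ait|ait]; last first.
    by rewrite subKr.
  have -> : w i = 0 by rewrite /w (max_idPl ait) mul0r.
  by rewrite !subr0 ler_wpM2l // -subr_le0.
apply: (le_trans (ler_sum _ (fun i _ => step i))).
by rewrite -mulr_suml sumrB smu sw subrr mul0r.
Qed.

Definition weight chi a : I -> R := xget (fun=> 0) [set w | is_weight chi a w].

Definition smax chi a : R :=
  \sum_i weight chi a i * a i - chi / 2 * \sum_i weight chi a i ^+ 2.

Lemma weightP chi a (i0 : I) : 0 < chi -> is_weight chi a (weight chi a).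
Proof.
by move=> chi0; have [w wP] := exists_weight chi a i0 chi0; apply: xgetPex; exists w.
Qed.

(** The difference of the two sides is exactly minus the left-hand side of the
    variational inequality for the weights at b, tested against the weights at
    a. *)
Lemma smax_tangent chi a b (i0 : I) : 0 < chi ->
  smax chi a + \sum_i weight chi a i * (b i - a i)
    + chi / 2 * \sum_i (weight chi b i - weight chi a i) ^+ 2 <= smax chi b.
Proof.
move=> chi0; have [wa0 sa _ _] := weightP chi a i0 chi0.
have [_ _ /(_ _ wa0 sa) opt _] := weightP chi b i0 chi0.
rewrite /smax; set wa := weight chi a in opt *; set wb := weight chi b in opt *.
rewrite -subr_ge0; suff -> : \sum_i wb i * b i - chi / 2 * \sum_i wb i ^+ 2 -
  (\sum_i wa i * a i - chi / 2 * \sum_i wa i ^+ 2 + \sum_i wa i * (b i - a i) +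
   chi / 2 * \sum_i (wb i - wa i) ^+ 2) =
   - \sum_i (wa i - wb i) * (b i - chi * wb i) by rewrite oppr_ge0.
by rewrite !mulr_sumr -!(sumrN, big_split) /=; apply: eq_bigr => i _; field.
Qed.

(** Exchange a and b in smax_tangent; its quadratic term absorbs the error
    coming from the change of weights, by completing the square. *)
Lemma smax_upper chi a b (i0 : I) : 0 < chi ->
  smax chi b <= smax chi a + \sum_i weight chi a i * (b i - a i)
    + (chi * 2)^-1 * \sum_i (b i - a i) ^+ 2.
Proof.
move=> chi0; have := smax_tangent chi b a i0 chi0.
set wa := weight chi a; set wb := weight chi b => tg.
rewrite -lerBlDl; apply: le_trans (_ : _ <= \sum_i (wb i - wa i) * (b i - a i)
    - chi / 2 * \sum_i (wa i - wb i) ^+ 2) _.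
  rewrite lerBrDr; apply: le_trans (_ : _ <= - \sum_i wb i * (a i - b i)
    - \sum_i wa i * (b i - a i)) _; first by lra.
  rewrite -!sumrN -big_split /=; apply: ler_sum => i _.
  by rewrite le_eqVlt; apply/orP; left; apply/eqP; ring.
rewrite !mulr_sumr -!(sumrN, big_split) /=; apply: ler_sum => i _.
rewrite -subr_ge0.
have -> : (chi * 2)^-1 * (b i - a i) ^+ 2 -
   ((wb i - wa i) * (b i - a i) - chi / 2 * (wa i - wb i) ^+ 2) =
   (chi * 2)^-1 * (b i - a i - chi * (wb i - wa i)) ^+ 2.
  by field; rewrite gt_eqF.
by rewrite mulr_ge0 ?sqr_ge0 // invr_ge0 mulr_ge0 // ltW.
Qed.

(** Compare the quadratic gains of smax_tangent and smax_upper. *)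
Lemma weight_lipschitz chi a b (i0 : I) : 0 < chi ->
  chi ^+ 2 * \sum_i (weight chi b i - weight chi a i) ^+ 2 <= \sum_i (b i - a i) ^+ 2.
Proof.
move=> chi0; have := smax_tangent chi a b i0 chi0; have := smax_upper chi a b i0 chi0.
set D := \sum_i (weight chi b i - weight chi a i) ^+ 2.
set E := \sum_i (b i - a i) ^+ 2 => up lo.
have {up lo} h : chi / 2 * D <= (chi * 2)^-1 * E by lra.
rewrite -(ler_pM2l (_ : 0 < (chi * 2)^-1)) ?invr_gt0 ?mulr_gt0 //.
apply: le_trans h; rewrite le_eqVlt; apply/orP; left; apply/eqP.
by field; rewrite gt_eqF.
Qed.

(** The vertex i of the simplex already gives the value a i - chi / 2. *)
Lemma smax_ge chi a (i : I) : 0 < chi -> a i - chi / 2 <= smax chi a.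
Proof.
move=> chi0; have [w0 sw opt _] := weightP chi a i chi0.
rewrite /smax; set w := weight chi a in w0 sw opt *.
have {}opt : \sum_j ((j == i)%:R - w j) * (a j - chi * w j) <= 0.
  apply: opt => [j|]; first exact: ler0n.
  by rewrite (bigD1 i) //= eqxx big1 ?addr0 // => j /negPf ->.
have split_opt : \sum_j ((j == i)%:R - w j) * (a j - chi * w j)
    = (a i - chi * w i) - (\sum_j w j * a j - chi * \sum_j w j ^+ 2).
  under eq_bigr do rewrite mulrBl.
  rewrite sumrB; congr (_ - _).
    rewrite (bigD1 i) //= eqxx mul1r big1 ?addr0 // => j /negPf ->.
    by rewrite mul0r.
  by rewrite mulr_sumr -sumrB; apply: eq_bigr => j _; ring.
have sq : w i ^+ 2 <= \sum_j w j ^+ 2.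
  by rewrite (bigD1 i) //= lerDl; apply: sumr_ge0 => j _; rewrite sqr_ge0.
rewrite split_opt in opt.
have sq0 := mulr_ge0 (ltW chi0) (sqr_ge0 (1 - w i)).
have := ler_wpM2l (ltW chi0) sq; nra.
Qed.

Lemma smax_le chi a m (i0 : I) : 0 < chi -> (forall i, a i <= m) ->
  smax chi a <= m.
Proof.
move=> chi0 am; have [w0 sw _ _] := weightP chi a i0 chi0.
rewrite /smax lerBlDr ler_wpDr //.
  by rewrite mulr_ge0 ?divr_ge0 ?(ltW chi0) //; apply: sumr_ge0 => i _; rewrite sqr_ge0.
rewrite -[leRHS]mul1r -sw mulr_suml; apply: ler_sum => i _.
by rewrite ler_wpM2l.
Qed.

(** Entries lying chi or more below another entry are inert: changing them among
    such values alters neither the weights nor the value. They carry no weight,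
    so the linear terms of the tangent inequalities at a and at b both vanish;
    the two inequalities together then force the quadratic term to be 0. *)
Lemma smax_local chi a b (i0 : I) : 0 < chi -> a i0 = b i0 ->
  (forall j, a j = b j \/ a j <= a i0 - chi /\ b j <= b i0 - chi) ->
  weight chi a = weight chi b /\ smax chi a = smax chi b.
Proof.
move=> chi0 ab0 ab.
have [_ _ _ za] := weightP chi a i0 chi0; have [_ _ _ zb] := weightP chi b i0 chi0.
have tab := smax_tangent chi a b i0 chi0; have tba := smax_tangent chi b a i0 chi0.
set wa := weight chi a in za tab tba *; set wb := weight chi b in zb tab tba *.
have sa0 : \sum_i wa i * (b i - a i) = 0.
  apply: big1 => i _; have [->|[/za -> _]] := ab i; last by rewrite mul0r.
  by rewrite subrr mulr0.
have sb0 : \sum_i wb i * (a i - b i) = 0.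
  apply: big1 => i _; have [->|[_ /zb ->]] := ab i; last by rewrite mul0r.
  by rewrite subrr mulr0.
rewrite sa0 addr0 in tab; rewrite sb0 addr0 in tba.
have sym : \sum_i (wa i - wb i) ^+ 2 = \sum_i (wb i - wa i) ^+ 2.
  by apply: eq_bigr => i _; ring.
rewrite sym in tba; set D := \sum_i (wb i - wa i) ^+ 2 in sym tab tba.
have D0 : 0 <= D by apply: sumr_ge0 => i _; rewrite sqr_ge0.
have cD0 := mulr_ge0 (ltW chi0) D0.
split; last by apply/eqP; rewrite eq_le; apply/andP; split; lra.
have cDE : chi * D = 0 by lra.
move/eqP: cDE; rewrite mulf_eq0 gt_eqF //= => /eqP D_eq0.
apply/funext => i; apply/eqP; rewrite eq_sym -subr_eq0 -sqrf_eq0.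
by have /psumr_eq0P -> := D_eq0 => // j _; rewrite sqr_ge0.
Qed.

End SmoothedMaximum.

(** * Differentiability and convexity from tangent inequalities *)

Lemma differentiable_of_littleo {R : realType} {V W : normedModType R}
    (f : V -> W) (df : {linear V -> W}) (x : V) : continuous df ->
  (forall e : R, 0 < e -> \forall h \near (0 : V), `|f (h + x) - f x - df h| <= e * `|h|) ->
  differentiable f x /\ 'd f x = df :> (V -> W).
Proof.
move=> df_cont fe.
have expansion : f \o shift x = cst (f x) + df +o_ (0 : V) id.
  apply/eqaddoP => e e0; near=> h.
  rewrite [X in `|X|](_ : _ = f (h + x) - f x - df h).
    by near: h; exact: fe.
  by rewrite !fctE /= opprD addrA.
have dE := diff_unique df_cont expansion.
by split=> //; apply/diff_locallyP; rewrite dE.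
Unshelve. all: by end_near.
Qed.

Section Calculus.
Context {R : realType} {n : nat}.
Implicit Types (f : 'rV[R]_n -> R) (g : 'rV[R]_n -> 'rV[R]_n) (x y v : 'rV[R]_n).

Definition dot v x : R := \sum_i v 0 i * x 0 i.

Lemma dot_is_linear v : linear (dot v).
Proof.
move=> k x y; rewrite /dot scaler_sumr -big_split /=; apply: eq_bigr => i _.
by rewrite !mxE /= /GRing.scale /=; ring.
Qed.

HB.instance Definition _ v :=
  GRing.isLinear.Build R 'rV[R]_n R *:%R (dot v) (dot_is_linear v).

Lemma dot_continuous v : continuous (dot v).
Proof.
apply: continuous_finsum => i x; apply: continuousM; first exact: cst_continuous.
exact: coord_continuous.
Qed.

Lemma coord_le_norm x i : `|x 0 i| <= `|x|.
Proof.
rewrite [leRHS]/Num.Def.normr /= mx_normrE.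
exact: (@le_bigmax _ _ _ 0 (fun ij : 'I_1 * 'I_n => `|x ij.1 ij.2|) (0, i)).
Qed.

(** The norm of row vectors that governs differentiability is the sup norm; the
    factor n in the proof compares it with the sum of squares. *)
Lemma differentiable_of_quadratic f x v (C : R) : 0 <= C ->
  (forall y, `|f y - f x - dot v (y - x)| <= C * \sum_i (y - x) 0 i ^+ 2) ->
  differentiable f x /\ gradient f x = v.
Proof.
move=> C0 fC.
have C1 : 0 < 1 + C * n%:R by rewrite ltr_pwDl // mulr_ge0.
have [df dE] : differentiable f x /\ 'd f x = dot v :> ('rV[R]_n -> R^o).
  apply: differentiable_of_littleo => [|e e0]; first exact: dot_continuous.
  near=> h.
  have hsmall : `|h| <= e / (1 + C * n%:R).
    near: h; apply/nbhs_ballP; exists (e / (1 + C * n%:R)) => /=.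
      by rewrite divr_gt0.
    by move=> h; rewrite -ball_normE /= sub0r normrN => /ltW.
  have := fC (h + x); rewrite addrK => fh.
  apply: (le_trans fh); apply: (@le_trans _ _ (C * (n%:R * `|h| ^+ 2))).
    rewrite ler_wpM2l // -[X in X%:R * _]card_ord mulr_natl -sumr_const.
    apply: ler_sum => i _; rewrite -real_normK ?num_real //.
    by rewrite lerXn2r ?nnegrE // coord_le_norm.
  rewrite mulrA expr2 mulrA ler_wpM2r //.
  move: hsmall; rewrite ler_pdivlMr //; apply: le_trans.
  by rewrite mulrC ler_wpM2l // lerDr.
split=> //; apply/rowP => i; rewrite mxE deriveE // dE /dot (bigD1 i) //= mxE !eqxx.
by rewrite mulr1 big1 ?addr0 // => j /negPf ji; rewrite mxE eqxx ji mulr0.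
Unshelve. all: by end_near.
Qed.

(** Average the supporting inequalities at the barycenter of x and y: the linear
    terms cancel. *)
Lemma convex_of_support f g :
  (forall x y, f x + dot (g x) (y - x) <= f y) -> convex_function [set: 'rV[R]_n] f.
Proof.
move=> supp t x y _ _; rewrite convRE.
set z : 'rV[R]_n := (X in f X <= _).
have zE : z = t%:num *: x + (1 - t%:num) *: y by [].
have t0 : 0 <= t%:num by [].
have t1 : 0 <= 1 - t%:num by rewrite subr_ge0.
have := ler_wpM2l t0 (supp z x); have := ler_wpM2l t1 (supp z y).
have : t%:num * dot (g z) (x - z) + (1 - t%:num) * dot (g z) (y - z) = 0.
  rewrite -!linearZ /= -linearD /= [X in dot _ X](_ : _ = 0) ?linear0 //.
  by rewrite zE; apply/rowP => i; rewrite !mxE; ring.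
by move=> d0 hy hx; change (f z <= t%:num * f x + (1 - t%:num) * f y); lra.
Qed.

End Calculus.

(** * The worst-case function and its resisting oracle *)

Section HardFunction.
Context {R : realType} {n : nat}.
Implicit Types (L chi nu : R) (xi c : 'I_n -> R) (x y : 'rV[R]_n).

Definition piece xi c x (i : 'I_n) : R := xi i * x 0 i - c i.

Definition hard L chi xi c x : R := L * smax chi (piece xi c x).

Definition hard_grad L chi xi c x : 'rV[R]_n :=
  \row_i (L * (xi i * weight chi (piece xi c x) i)).

Lemma pieceB xi c x y i : piece xi c y i - piece xi c x i = xi i * (y - x) 0 i.
Proof. by rewrite /piece !mxE; ring. Qed.

Lemma sum_pieceB_le xi c x y : (forall i, `|xi i| <= 1) ->
  \sum_i (piece xi c y i - piece xi c x i) ^+ 2 <= \sum_i (y - x) 0 i ^+ 2.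
Proof.
move=> xi1; apply: ler_sum => i _; rewrite pieceB exprMn.
by rewrite ler_piMl ?sqr_ge0 // -real_normK ?num_real // expr_le1.
Qed.

Lemma dot_hard_grad L chi xi c x y : dot (hard_grad L chi xi c x) (y - x) =
  L * \sum_i weight chi (piece xi c x) i * (piece xi c y i - piece xi c x i).
Proof.
by rewrite /dot mulr_sumr; apply: eq_bigr => i _; rewrite pieceB mxE; ring.
Qed.

Lemma hard_support L chi xi c x y (i0 : 'I_n) : 0 <= L -> 0 < chi ->
  hard L chi xi c x + dot (hard_grad L chi xi c x) (y - x) <= hard L chi xi c y.
Proof.
move=> L0 chi0; rewrite dot_hard_grad /hard -mulrDr ler_wpM2l //.
apply: le_trans (smax_tangent chi (piece xi c x) (piece xi c y) i0 chi0).
rewrite lerDl mulr_ge0 ?divr_ge0 ?(ltW chi0) //.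
by apply: sumr_ge0 => i _; rewrite sqr_ge0.
Qed.

Lemma hard_differentiable L chi xi c x (i0 : 'I_n) : 0 <= L -> 0 < chi ->
  (forall i, `|xi i| <= 1) ->
  differentiable (hard L chi xi c) x /\
  gradient (hard L chi xi c) x = hard_grad L chi xi c x.
Proof.
move=> L0 chi0 xi1.
have C0 : 0 <= L / (chi * 2) by rewrite divr_ge0 // mulr_ge0 // ltW.
apply: (differentiable_of_quadratic _ _ _ _ C0) => y.
have lo := hard_support L chi xi c x y i0 L0 chi0.
rewrite ger0_norm; last by lra.
rewrite dot_hard_grad /hard -mulrBr -mulrBr -mulrA ler_wpM2l //.
have up := smax_upper chi (piece xi c x) (piece xi c y) i0 chi0.
apply: le_trans (_ : _ <= (chi * 2)^-1 * \sum_i (piece xi c y i - piece xi c x i) ^+ 2) _.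
  by lra.
by rewrite ler_wpM2l ?sum_pieceB_le // invr_ge0 mulr_ge0 // ltW.
Qed.

Lemma sqrtr_le (u v : R) : 0 <= v -> u <= v ^+ 2 -> Num.sqrt u <= v.
Proof. by move=> v0 uv; rewrite -[leRHS]ger0_norm // -sqrtr_sqr ler_wsqrtr. Qed.

Lemma enorm_ge0 x : 0 <= enorm x.
Proof. exact: sqrtr_ge0. Qed.

Lemma enorm_sqr x : enorm x ^+ 2 = \sum_i x 0 i ^+ 2.
Proof. by rewrite sqr_sqrtr // sumr_ge0 // => i _; rewrite sqr_ge0. Qed.

(** A quantity bounded both by 2 and by t is bounded by their weighted geometric
    mean. *)
Lemma le_interpolation (D t nu : R) : 0 <= D -> 0 <= t -> D <= 2 -> D <= t ->
  0 <= nu -> nu <= 1 -> D <= 2 `^ (1 - nu) * t `^ nu.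
Proof.
move=> D0 t0 D2 Dt nu0 nu1; have [->|Dn0] := eqVneq D 0.
  by rewrite mulr_ge0 // powR_ge0.
have -> : D = D `^ (1 - nu) * D `^ nu.
  by rewrite -powRD ?Dn0 ?implybT // subrK powRr1.
by apply: ler_pM; rewrite ?powR_ge0 // ge0_ler_powR ?nnegrE ?subr_ge0.
Qed.

(** The weights are (1/chi)-Lipschitz and move by at most 2, since
    (u - v)^2 <= u + v for u and v in [0, 1]; le_interpolation combines the two
    bounds. Multiplying the i-th weight by xi_i does not increase distances. *)
Lemma hard_holder L chi nu xi c (i0 : 'I_n) : 0 <= L -> 0 < chi ->
  0 <= nu -> nu <= 1 -> (forall i, `|xi i| <= 1) ->
  holder_gradient nu (L * (2 `^ (1 - nu) * (chi^-1) `^ nu)) (hard L chi xi c).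
Proof.
move=> L0 chi0 nu0 nu1 xi1 x y.
have [_ ->] := hard_differentiable L chi xi c x i0 L0 chi0 xi1.
have [_ ->] := hard_differentiable L chi xi c y i0 L0 chi0 xi1.
set w := fun x => weight chi (piece xi c x).
pose D2 := \sum_i (w x i - w y i) ^+ 2.
have D20 : 0 <= D2 by apply: sumr_ge0 => i _; rewrite sqr_ge0.
have gradD : enorm (hard_grad L chi xi c x - hard_grad L chi xi c y) <= L * Num.sqrt D2.
  apply: sqrtr_le; first by rewrite mulr_ge0 // sqrtr_ge0.
  rewrite exprMn sqr_sqrtr // mulr_sumr; apply: ler_sum => i _; rewrite !mxE.
  rewrite -mulrBr -mulrBr !exprMn ler_wpM2l ?sqr_ge0 //.
  by rewrite ler_piMl ?sqr_ge0 // -real_normK ?num_real // expr_le1.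
apply: (le_trans gradD); rewrite -!mulrA ler_wpM2l // -powRM ?enorm_ge0 ?invr_ge0 ?(ltW chi0) //.
apply: le_interpolation => //.
- by rewrite mulr_ge0 ?enorm_ge0 // invr_ge0 ltW.
- apply: sqrtr_le => //.
  have [wx0 swx _ _] := weightP chi (piece xi c x) i0 chi0.
  have [wy0 swy _ _] := weightP chi (piece xi c y) i0 chi0.
  have le1 (v : 'I_n -> R) : (forall i, 0 <= v i) -> \sum_i v i = 1 -> forall i, v i <= 1.
    move=> v0 <- i; rewrite (bigD1 i) //= lerDl.
    by apply: sumr_ge0.
  apply: (@le_trans _ _ (\sum_i (w x i + w y i))); last first.
    by rewrite big_split /= swx swy; lra.
  apply: ler_sum => i _.
  have := wx0 i; have := wy0 i; have := le1 _ wx0 swx i; have := le1 _ wy0 swy i.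
  by rewrite /w; nra.
- apply: sqrtr_le; first by rewrite mulr_ge0 ?enorm_ge0 // invr_ge0 ltW.
  rewrite exprMn enorm_sqr exprVn mulrC ler_pdivlMr ?exprn_gt0 // mulrC.
  apply: le_trans (weight_lipschitz chi (piece xi c y) (piece xi c x) i0 chi0) _.
  exact: sum_pieceB_le.
Qed.

(** If the data of two functions differ only in pieces that lie chi or more below
    a common piece i0 at x, the oracle cannot tell the functions apart at x. *)
Lemma hard_oracle_local L chi xi c xi' c' x (i0 : 'I_n) : 0 <= L -> 0 < chi ->
  (forall i, `|xi i| <= 1) -> (forall i, `|xi' i| <= 1) ->
  xi i0 = xi' i0 -> c i0 = c' i0 ->
  (forall j, xi j = xi' j /\ c j = c' j \/
     piece xi c x j <= piece xi c x i0 - chi /\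
     piece xi' c' x j <= piece xi' c' x i0 - chi) ->
  oracle (hard L chi xi c) x = oracle (hard L chi xi' c') x.
Proof.
move=> L0 chi0 xi1 xi1' exi ec same.
have [_ gE] := hard_differentiable L chi xi c x i0 L0 chi0 xi1.
have [_ gE'] := hard_differentiable L chi xi' c' x i0 L0 chi0 xi1'.
have pE : piece xi c x i0 = piece xi' c' x i0 by rewrite /piece exi ec.
have same' j : piece xi c x j = piece xi' c' x j \/
     piece xi c x j <= piece xi c x i0 - chi /\
     piece xi' c' x j <= piece xi' c' x i0 - chi.
  by case: (same j) => [[e1 e2]|]; [left; rewrite /piece e1 e2|right].
have [wE sE] := smax_local chi _ _ i0 chi0 pE same'.
rewrite /oracle gE gE' /hard sE /hard_grad wE; congr pair.
apply/rowP => j; rewrite !mxE; case: (same j) => [[-> _ //]|[_ inert]].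
have [_ _ _ /(_ _ _ inert) ->] := weightP chi (piece xi' c' x) i0 chi0.
by rewrite !mulr0.
Qed.

(** The functions the adversary may still end up with once it has committed to
    the signs xi and the offsets c on S. Any value in [-1, 1] is allowed for xi'
    outside S, so that 0 can be used on coordinates that are never revealed. *)
Definition completes chi (S : {set 'I_n}) xi c xi' c' :=
  (forall i, i \in S -> xi' i = xi i /\ c' i = c i) /\
  (forall i, i \notin S -> `|xi' i| <= 1 /\ #|S|%:R * chi <= c' i).

(** Induction on the number k of queries. All completions of the data committed
    so far give the same k answers, hence the same next point x. The new index
    i maximizes the absolute value of x_i outside S; with offset k * chi its
    piece exceeds every piece left open, whose slope is at most 1 and whose
    offset is at least (k + 1) * chi, by at least chi. By hard_oracle_local the
    answer at x is then the same for all completions of the extended data. *)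
Lemma resisting_oracle (A : algorithm R n) L chi k : 0 <= L -> 0 < chi -> (k <= n)%N ->
  exists (S : {set 'I_n}) xi c ans,
    [/\ #|S| = k,
        forall i, i \in S -> `|xi i| = 1 /\ 0 <= c i <= k%:R * chi - chi &
        forall xi' c', completes chi S xi c xi' c' ->
          answers A (hard L chi xi' c') k = ans /\
          ((0 < k)%N -> exists2 i, i \in S &
             0 <= xi i * query A (hard L chi xi' c') k.-1 0 i)].
Proof.
move=> L0 chi0; elim: k => [|k IH] kn.
  exists finset.set0, (fun=> 0), (fun=> 0), [tuple].
  by split=> [|i|xi' c' _]; rewrite ?cards0 ?inE.
have [S [xi [c [ans [cS SP ansP]]]]] := IH (ltnW kn).
pose x := A k ans.
have [j0 j0S] : exists j, j \notin S.
  apply/existsP; rewrite -negb_forall; apply/negP => /forallP allS.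
  move: kn; rewrite -cS -[n in (_ < n)%N]card_ord ltnNge => /negP; apply.
  by apply: subset_leq_card; apply/fintype.subsetP => i _; exact: allS.
have [i iS imax] : exists2 i, i \notin S & forall j, j \notin S -> `|x 0 j| <= `|x 0 i|.
  by case: (@arg_maxP _ _ _ j0 (fun j => j \notin S) (fun j => `|x 0 j|) j0S) => i; exists i.
pose s : R := if 0 <= x 0 i then 1 else -1.
have s1 : `|s| = 1 by rewrite /s; case: ifP; rewrite ?normrN normr1.
have sx : s * x 0 i = `|x 0 i|.
  rewrite /s; case: ifPn => [h|]; first by rewrite mul1r ger0_norm.
  by rewrite -ltNge => h; rewrite mulN1r ltr0_norm.
pose xi1 j := if j == i then s else xi j.
pose c1 j := if j == i then k%:R * chi else c j.
have neq_i j : j \in S -> j == i = false.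
  by move=> jS; apply/negbTE; apply: contraNneq iS => <-.
have cS1 : #|(i |: S)%SET| = k.+1 by rewrite cardsU1 iS cS.
have restrict xi' c' : completes chi (i |: S)%SET xi1 c1 xi' c' -> completes chi S xi c xi' c'.
  move=> [inS outS]; split=> j jS.
    by have := inS j; rewrite !inE jS orbT /xi1 /c1 neq_i // => /(_ isT).
  have [ji|ji] := eqVneq j i; last first.
    have [|xij cj] := outS j; first by rewrite !inE negb_or ji.
    split=> //; apply: le_trans cj; rewrite cS1 cS ler_wpM2r ?ler_nat //.
    exact: ltW.
  have [|-> ->] := inS j; first by rewrite !inE ji eqxx.
  by rewrite /xi1 /c1 ji eqxx s1 cS lexx.
have norm1 xi' c' : completes chi (i |: S)%SET xi1 c1 xi' c' -> forall j, `|xi' j| <= 1.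
  move=> comp j; have [inS outS] := restrict _ _ comp.
  have [jS|jS] := boolP (j \in S); last by have [] := outS j jS.
  by have [-> _] := inS j jS; have [-> _] := SP j jS.
have queryE xi' c' : completes chi (i |: S)%SET xi1 c1 xi' c' ->
    query A (hard L chi xi' c') k = x.
  by move=> /restrict comp; rewrite /query; have [-> _] := ansP _ _ comp.
(* One particular completion, whose answers serve as the common answers. *)
pose xi0 j := if j \in (i |: S)%SET then xi1 j else 0.
pose c0 j := if j \in (i |: S)%SET then c1 j else k.+1%:R * chi.
have comp0 : completes chi (i |: S)%SET xi1 c1 xi0 c0.
  split=> [j jS|j /negPf jS]; rewrite /xi0 /c0 jS //.
  by rewrite normr0 ler01 cS1.
exists (i |: S)%SET, xi1, c1, (answers A (hard L chi xi0 c0) k.+1); split=> //.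
  move=> j; rewrite !inE /xi1 /c1; case: eqP => [_ _|_ /= jS].
    rewrite s1 -natr1 mulrDl mul1r addrK lexx andbT mulr_ge0 //.
    exact: ltW.
  have [-> /andP[-> cj]] := SP j jS; split=> //=; apply: le_trans cj _.
  by rewrite lerD2r ler_wpM2r ?ler_nat // ltW.
move=> xi' c' comp; split; last first.
  move=> _; exists i; first by rewrite !inE eqxx.
  by rewrite queryE // /xi1 eqxx sx.
have inert xi2 c2 j : completes chi (i |: S)%SET xi1 c1 xi2 c2 -> j \notin (i |: S)%SET ->
    piece xi2 c2 x j <= piece xi2 c2 x i - chi.
  move=> [inS outS] jS; have [xij cj] := outS j jS.
  rewrite /piece; have [|-> ->] := inS i; first by rewrite !inE eqxx.
  rewrite /xi1 /c1 eqxx sx.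
  rewrite cS1 -natr1 in cj.
  have xj : xi2 j * x 0 j <= `|x 0 i|.
    apply: le_trans (ler_norm _) _; rewrite normrM.
    apply: (@le_trans _ _ (`|x 0 j|)); first by rewrite ler_piMl.
    by apply: imax; move: jS; rewrite !inE negb_or => /andP[].
  lra.
have step : oracle (hard L chi xi' c') x = oracle (hard L chi xi0 c0) x.
  have [inS _] := comp; have [inS0 _] := comp0.
  apply: (hard_oracle_local _ _ _ _ _ _ _ i) => //.
  - exact: norm1 comp.
  - exact: norm1 comp0.
  - by have [|-> _] := inS i; [|have [|-> _] := inS0 i]; rewrite ?inE ?eqxx.
  - by have [|_ ->] := inS i; [|have [|_ ->] := inS0 i]; rewrite ?inE ?eqxx.
  - move=> j; have [jS|jS] := boolP (j \in (i |: S)%SET).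
      by left; have [-> ->] := inS j jS; have [-> ->] := inS0 j jS.
    by right; split; apply: inert.
apply: val_inj => /=.
have [-> _] := ansP _ _ (restrict _ _ comp).
by have [-> _] := ansP _ _ (restrict _ _ comp0); rewrite -/x step.
Qed.

End HardFunction.

(** * Existence of minimizers for the regularized problem *)

Section Minimizer.
Context {R : realType} {n : nat}.
Implicit Types (F f : 'rV[R]_n -> R) (x : 'rV[R]_n).

(** The absolute value is needed at 0: t `^ s is 1 for negative t, hence not
    continuous there. *)
Lemma continuous_norm_powR (s : R) : 0 < s -> continuous (fun t : R => `|t| `^ s).
Proof.
move=> s0 t; have [->|tn0] := eqVneq t 0.
  apply/cvgrPdist_le => e e0; rewrite normr0 powR0 ?gt_eqF //.
  near=> u; rewrite sub0r normrN ger0_norm ?powR_ge0 //.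
  rewrite -[leRHS](powRr1 (ltW e0)) -[X in e `^ X](@mulVf _ s) ?gt_eqF //.
  rewrite powRrM; apply: ge0_ler_powR; rewrite ?nnegrE ?powR_ge0 ?(ltW s0) //.
  near: u; apply/nbhs_ballP; exists (e `^ s^-1); first exact: powR_gt0.
  by move=> u /=; rewrite sub0r normrN => /ltW.
apply: (@continuous_comp _ _ _ (fun u : R => `|u|) (fun u => u `^ s)).
  exact: norm_continuous.
apply/differentiable_continuous/derivable1_diffP/derivable_powR.
by rewrite in_itv /= andbT normr_gt0.
Unshelve. all: by end_near.
Qed.

Lemma sum_powR_ge0 (q : R) x : 0 <= \sum_i `|x 0 i| `^ q.
Proof. by apply: sumr_ge0 => i _; exact: powR_ge0. Qed.

Lemma continuous_lqnorm_powR (p q : R) : 0 < p -> 0 < q ->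
  continuous (fun x => lqnorm q x `^ p).
Proof.
move=> p0 q0 x.
have -> : (fun x => lqnorm q x `^ p) =
    (fun t => `|t| `^ p) \o (fun t => `|t| `^ q^-1) \o (fun x => \sum_i `|x 0 i| `^ q).
  apply/funext => y /=.
  by rewrite (ger0_norm (powR_ge0 _ _)) ger0_norm ?sum_powR_ge0.
apply: continuous_comp; last first.
  apply: continuous_comp; apply: continuous_norm_powR => //; rewrite invr_gt0 //.
apply: continuous_finsum => i y.
apply: (@continuous_comp _ _ _ (fun z : 'rV[R]_n => z 0 i) (fun t => `|t| `^ q)).
  exact: coord_continuous.
exact: continuous_norm_powR.
Qed.

Lemma norm_le_lqnorm (q : R) x : 0 < q -> `|x| <= lqnorm q x.
Proof.
move=> q0; rewrite [leLHS]/Num.Def.normr /= mx_normrE.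
apply: bigmax_le => [|[j i] _ /=]; first exact: powR_ge0.
rewrite (ord1 j) -[leLHS](@powRr1 R) // -[X in _ `^ X <= _](@mulfV _ q) ?gt_eqF //.
rewrite powRrM; apply: ge0_ler_powR;
  rewrite ?nnegrE ?powR_ge0 ?sum_powR_ge0 ?invr_ge0 ?(ltW q0) //.
by rewrite (bigD1 i) //= lerDl sumr_ge0 // => k _; exact: powR_ge0.
Qed.

Lemma coercive_min F (B : R) : continuous F ->
  (forall x, B <= `|x| -> F 0 <= F x) -> exists m, is_min_value F m.
Proof.
move=> F_cont F_big.
pose K := [set x : 'rV[R]_n | `|x| <= Num.max 0 B]%classic.
have K0 : K 0 by rewrite /K /= normr0 le_max lexx.
have Kc : compact K.
  apply: bounded_closed_compact.
    exists (Num.max 0 B); split; first exact: num_real.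
    by move=> M BM x; rewrite /K /= => /le_trans; apply; exact: ltW.
  apply: (@closed_comp _ _ (fun x : 'rV[R]_n => `|x|) [set t | t <= Num.max 0 B]%classic).
    by move=> x _; exact: norm_continuous.
  exact: closed_le.
have [||c _ cmin] := @compact_EVT_min _ _ F K _ Kc.
- by exists 0.
- exact: continuous_subspaceT.
exists (F c); split=> [|x]; first by exists c.
have [xK|] := leP `|x| (Num.max 0 B); first by apply: cmin; rewrite inE.
rewrite gt_max => /andP[_ /ltW/F_big]; apply: le_trans.
by apply: cmin; rewrite inE.
Qed.

(** Since p >= 2, the regularizer dominates a multiple of |x|^2 outside the unit
    ball and outgrows the linear lower bound on f; the radius B is chosen so
    that F x >= F 0 whenever |x| >= B. *)
Lemma regularized_min f (p q sigma K L : R) : 2 <= p -> 1 <= q -> 0 < sigma ->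
  continuous f -> (forall x, - K - L * `|x| <= f x) ->
  exists m, is_min_value (regularized sigma p q f) m.
Proof.
move=> p2 q1 sigma0 f_cont f_ge.
have p0 : 0 < p by lra.
have q0 : 0 < q by lra.
pose F := regularized sigma p q f.
pose B := 1 + p / sigma * (`|L| + `|K + F 0|).
apply: (@coercive_min _ B) => [x|x Bx].
  apply: (@continuousD _ R^o _ f (fun x => sigma / p * lqnorm q x `^ p)).
    exact: f_cont.
  apply: continuousM; first exact: cst_continuous.
  exact: continuous_lqnorm_powR.
set t := `|x| in Bx.
have t0 : 0 <= t by exact: normr_ge0.
have t1 : 1 <= t.
  by apply: le_trans Bx; rewrite lerDl mulr_ge0 ?addr_ge0 // divr_ge0 // ltW.
have tt : t * t <= lqnorm q x `^ p.
  apply: (@le_trans _ _ (t `^ p)).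
    by rewrite -expr2 -powR_mulrn ?ler_powR //; lra.
  apply: ge0_ler_powR; rewrite ?nnegrE ?powR_ge0 ?(ltW p0) //.
  exact: norm_le_lqnorm.
have Bt : `|L| + `|K + F 0| <= sigma / p * t.
  rewrite -ler_pdivrMl ?divr_gt0 // invf_div; apply: le_trans Bx.
  by rewrite /B lerDr.
rewrite -/F; apply: (@le_trans _ _ (- K - L * t + sigma / p * (t * t))); last first.
  by apply: lerD; [exact: f_ge|rewrite ler_wpM2l // divr_ge0 // ltW].
have := ler_norm L; have := ler_norm (K + F 0); have := normr_ge0 (K + F 0).
have := ler_wpM2r t0 Bt; nra.
Qed.

End Minimizer.

(** * The choice of the parameters and the lower bound *)

(** With L = sigma T^(p/q) r^(p-1) and chi = ((p-1)/p) r / (8 T), the first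
    equation determines r. The bound on T * chi would allow a denominator 2 T;
    with 8 T the last identity holds as an equality. All quantities are positive,
    so the identities are proved on logarithms, where they are rational. *)
Lemma scaling_parameters (R : realType) (T : nat) (p q sigma nu H : R) :
  2 <= p -> 1 <= q -> 0 < sigma -> nu < p - 1 -> 0 < H -> (0 < T)%N ->
  exists r L chi : R,
    [/\ 0 < r, 0 < L & 0 < chi] /\
    [/\ L * (2 `^ (1 - nu) * chi^-1 `^ nu) = H,
        sigma * (T%:R `^ (p / q) * r `^ p) = L * r,
        T%:R * chi <= (p - 1) / p * r / 2 &
        ((p - 1) / p) `^ ((p - 1) * (1 + nu) / (p - 1 - nu))
        * (1 / 2) `^ ((2 * p - 1) * (1 + nu) / (p - 1 - nu))
        * (H / (sigma `^ ((1 + nu) / p)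
                * T%:R `^ ((1 + nu + nu * q) / q)))
          `^ (p / (p - 1 - nu)) = (p - 1) / p * (L * r) / 2].
Proof.
move=> p2 q1 sigma0 nup H0 T0.
have p0 : p != 0 by rewrite gt_eqF //; lra.
have q0 : q != 0 by rewrite gt_eqF //; lra.
have d0 : p - 1 - nu != 0 by rewrite gt_eqF //; lra.
have a0 : 0 < (p - 1) / p by rewrite divr_gt0; lra.
have expln (u : R) : 0 < u -> exists v, u = expR v.
  by move=> u0; exists (ln u); rewrite lnK // posrE.
have [a aE] := expln _ a0; have [t tE] := expln T%:R (ltac:(by rewrite ltr0n)).
have [s sE] := expln _ sigma0; have [h hE] := expln _ H0.
have [l lE] := expln 2 (ltr0n _ 2).
(* The logarithms of r and L. *)
pose rho := (h + nu * a - (1 + 2 * nu) * l - s - (p / q + nu) * t) / (p - 1 - nu).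
pose lam := s + p / q * t + (p - 1) * rho.
exists (expR rho), (expR lam), (expR (a + rho - 3 * l - t)).
split; first by rewrite !expR_gt0.
split.
- rewrite lE hE -expRN -!expRM -!expRD; congr expR.
  by rewrite /lam /rho; field; rewrite d0 q0.
- rewrite sE tE -!expRM -!expRD; congr expR.
  by rewrite /lam; field.
- rewrite tE aE lE -expRN -!expRD ler_expR.
  have : 0 < l by rewrite -ltr_expR expR0 -lE ltr1n.
  by lra.
(* Rewriting 2 as an exponential must not touch this exponent. *)
- have -> : 2 * p - 1 = p + p - 1 by ring.
  rewrite tE aE lE sE hE mul1r -!expRN -!expRM -!expRD -expRN -expRD -expRM -!expRD.
  congr expR.
  by rewrite /lam /rho; field; rewrite d0 q0 p0.
Qed.

Section LowerBound.
Context {R : realType} {n : nat}.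
Implicit Types (L chi r p q sigma : R) (xi c : 'I_n -> R) (x : 'rV[R]_n).

Lemma hard_ge L chi xi c x (i : 'I_n) : 0 <= L -> 0 < chi ->
  L * (xi i * x 0 i - c i - chi / 2) <= hard L chi xi c x.
Proof. by move=> L0 chi0; rewrite ler_wpM2l // smax_ge. Qed.

(** The offset of an unrevealed coordinate is at least r, so its constant piece
    does not lift the maximum above - r. *)
Lemma regularized_test_point L chi xi c r p q sigma (S : {set 'I_n}) (i0 : 'I_n) :
  0 <= L -> 0 < chi -> 0 <= r -> 0 < q ->
  (forall i, i \in S -> `|xi i| = 1 /\ 0 <= c i) ->
  (forall i, i \notin S -> xi i = 0 /\ r <= c i) ->
  regularized sigma p q (hard L chi xi c) (\row_i (- r * xi i)) <=
    - (L * r) + sigma / p * (#|S|%:R `^ (p / q) * r `^ p).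
Proof.
move=> L0 chi0 r0 q0 inS outS; rewrite /regularized.
have -> : lqnorm q (\row_i (- r * xi i)) = #|S|%:R `^ q^-1 * r.
  rewrite /lqnorm (bigID (fun i => i \in S)) /=.
  rewrite [X in _ + X]big1 ?addr0 => [|i /outS[xi0 _]]; last first.
    by rewrite mxE xi0 mulr0 normr0 powR0 ?gt_eqF.
  rewrite (eq_bigr (fun=> r `^ q)) => [|i /inS[xi1 _]]; last first.
    by rewrite mxE normrM normrN xi1 mulr1 ger0_norm.
  rewrite sumr_const -[_ *+ _]mulr_natl powRM ?powR_ge0 // -powRrM.
  by rewrite mulfV ?gt_eqF // powRr1.
rewrite powRM ?powR_ge0 // -powRrM [q^-1 * p]mulrC lerD2r -mulrN ler_wpM2l //.
apply: smax_le => // i; rewrite /piece mxE.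
have [/inS[xi1 ci]|/outS[-> ci]] := boolP (i \in S); last by lra.
have : xi i ^+ 2 = 1 by rewrite -real_normK ?num_real // xi1 expr1n.
by rewrite expr2 => e; nra.
Qed.

End LowerBound.

Theorem theorem5 (R : realType) (n T : nat) (p q sigma nu H : R)
    (hn : (1 <= n)%N) (hp : 2 <= p) (hq : 1 <= q) (hsigma : 0 < sigma)
    (hnu0 : 0 <= nu) (hnu1 : nu <= 1) (hnup : nu < p - 1) (hH : 0 < H)
    (hT1 : (1 <= T)%N) (hTn : (T <= n)%N) (A : algorithm R n) :
  exists f : 'rV[R]_n -> R,
    [/\ convex_function [set: 'rV[R]_n] f,
        (forall x : 'rV[R]_n, differentiable f x),
        holder_gradient nu H f &
        exists Fstar : R,
          is_min_value (regularized sigma p q f) Fstar /\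
          regularized sigma p q f (query A f T.-1) - Fstar >=
            ((p - 1) / p) `^ ((p - 1) * (1 + nu) / (p - 1 - nu))
            * (1 / 2) `^ ((2 * p - 1) * (1 + nu) / (p - 1 - nu))
            * (H / (sigma `^ ((1 + nu) / p)
                    * T%:R `^ ((1 + nu + nu * q) / q)))
              `^ (p / (p - 1 - nu))].
Proof.
pose i0 : 'I_n := Ordinal hn.
have q0 : 0 < q by lra.
have p0 : 0 < p by lra.
have [r [L [chi [[r0 L0 chi0] [HE rE chi_le ->]]]]] :=
  @scaling_parameters R T p q sigma nu H hp hq hsigma hnup hH hT1.
have [S [xi [c [ans [cS SP adversary]]]]] := resisting_oracle A L chi T (ltW L0) chi0 hTn.
(* Unrevealed coordinates get a constant piece, low enough to be inert at the
   query points and at the test point. *)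
pose xi' i := if i \in S then xi i else 0.
pose c' i := if i \in S then c i else T%:R * chi + r.
have comp : completes chi S xi c xi' c'.
  split=> [i iS|i /negPf iS]; rewrite /xi' /c' iS //.
  by rewrite normr0 ler01 cS lerDl (ltW r0).
have xi1 i : `|xi' i| <= 1.
  by rewrite /xi'; case: ifP => [/SP[-> _]|_]; rewrite ?normr0 ?ler01.
have [_ /(_ hT1)[i iS query_i]] := adversary _ _ comp.
pose f := hard L chi xi' c'; exists f.
have f_diff x := hard_differentiable L chi xi' c' x i0 (ltW L0) chi0 xi1.
split.
- apply: (convex_of_support f (hard_grad L chi xi' c')) => x y.
  exact: (hard_support L chi xi' c' x y i0 (ltW L0) chi0).
- by move=> x; have [] := f_diff x.
- by rewrite -HE; exact: (hard_holder L chi nu xi' c' i0 (ltW L0) chi0).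
have [||Fstar FstarP] := @regularized_min R n f p q sigma (L * (c' i0 + chi / 2)) L hp hq hsigma.
- by move=> x; apply/differentiable_continuous; have [] := f_diff x.
- move=> x; apply: le_trans (hard_ge L chi xi' c' x i0 (ltW L0) chi0).
  rewrite -opprD -mulrDr -mulrN ler_wpM2l ?(ltW L0) //.
  have : `|xi' i0 * x 0 i0| <= `|x|.
    by rewrite normrM (le_trans _ (coord_le_norm x i0)) // ler_piMl.
  by rewrite ler_norml => /andP[lo _]; lra.
exists Fstar; split=> //.
have at_query : - (L * (T%:R * chi)) <= regularized sigma p q f (query A f T.-1).
  rewrite /regularized -[leLHS]addr0 lerD //; last first.
    by rewrite mulr_ge0 ?powR_ge0 // divr_ge0 // ltW.
  apply: le_trans (hard_ge L chi xi' c' _ i (ltW L0) chi0).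
  rewrite -mulrN ler_wpM2l ?(ltW L0) //.
  move: query_i; rewrite -/f /xi' /c' iS.
  by have [_ /andP[_ ci]] := SP i iS; lra.
have at_test : Fstar <= - (L * r) + sigma / p * (#|S|%:R `^ (p / q) * r `^ p).
  apply: le_trans (_ : _ <= regularized sigma p q f (\row_j (- r * xi' j))) _.
    by have [_] := FstarP; apply.
  apply: regularized_test_point => //; rewrite ?(ltW L0) ?(ltW r0) // => j jS.
    by rewrite /xi' /c' jS; have [-> /andP[-> _]] := SP j jS.
  rewrite /xi' /c' (negPf jS); split=> //.
  by rewrite lerDr mulr_ge0 // ltW.
have rpE : sigma / p * (#|S|%:R `^ (p / q) * r `^ p) = L * r / p.
  by rewrite cS mulrAC rE.
rewrite rpE in at_test.
have := ler_wpM2l (ltW L0) chi_le.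
have -> : L * ((p - 1) / p * r / 2) = L * r / 2 - L * r / p / 2.
  by field; rewrite gt_eqF.
have -> : (p - 1) / p * (L * r) / 2 = L * r / 2 - L * r / p / 2.
  by field; rewrite gt_eqF.
by lra.
Qed.
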